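(* Let $n\ge 1$ and let $M\subseteq\mathbb{Z}^n$ be a submodule (subgroup). Then there are only finitely many max-compatible order ideals $\mathcal{O}\subseteq\mathbb{N}^n$ associated with $M$ (i.e. max-compatible mod $M$).
   Context: $\mathbb{N}$ denotes the non-negative integers. For $u,v\in\mathbb{N}^n$, $u\preceq v$ means every component of $u$ is at most the corresponding component of $v$, and $D(u)=\{v\in\mathbb{N}^n\mid v\preceq u\}$. An order ideal is a (finite or infinite) subset $\mathcal{O}\subseteq\mathbb{N}^n$ such that $u\in\mathcal{O}$ implies $D(u)\subseteq\mathcal{O}$. Elements $a,b\in\mathbb{Z}^n$ are equivalent mod $M$, written $a\equiv_M b$, if $a-b\in M$. An order ideal $\mathcal{O}$ is compatible (mod $M$) if $a,b\in\mathcal{O}$ and $a\equiv_M b$ imply $a=b$. It is max-compatible (mod $M$) if it is compatible and every element of $\mathbb{Z}^n$ is equivalent mod $M$ to some element of $\mathcal{O}$. *)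

(* Defs.v *)
(* MathComp world, with the classical sets of MathComp-Analysis. *)
From mathcomp Require Import all_boot all_order all_algebra.
From mathcomp Require Import boolp classical_sets cardinality.

Set Implicit Arguments.
Unset Strict Implicit.
Unset Printing Implicit Defensive.

Import Order.TTheory GRing.Theory Num.Theory.

Local Open Scope classical_set_scope.
Local Open Scope ring_scope.

(* N^n is ['rV[nat]_n] and Z^n is ['rV[int]_n]. *)

Definition prec (n : nat) (u v : 'rV[nat]_n) : Prop :=
  forall i : 'I_n, (u ord0 i <= v ord0 i)%N.

Definition down_set (n : nat) (u : 'rV[nat]_n) : set 'rV[nat]_n :=
  [set v | prec v u].

Definition order_ideal (n : nat) (O : set 'rV[nat]_n) : Prop :=
  forall u, O u -> down_set u `<=` O.

(* The inclusion of N^n in Z^n. *)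
Definition to_int (n : nat) (u : 'rV[nat]_n) : 'rV[int]_n := map_mx Posz u.

Definition eqmodM (n : nat) (M : set 'rV[int]_n) (a b : 'rV[int]_n) : Prop :=
  M (a - b).

Definition compatible (n : nat) (M : set 'rV[int]_n) (O : set 'rV[nat]_n) :
    Prop :=
  forall a b, O a -> O b -> eqmodM M (to_int a) (to_int b) -> a = b.

Definition max_compatible (n : nat) (M : set 'rV[int]_n)
    (O : set 'rV[nat]_n) : Prop :=
  compatible M O /\
  forall a : 'rV[int]_n, exists2 b, O b & eqmodM M a (to_int b).

(* Main.v *)
Require Import Defs.
From mathcomp Require Import all_boot all_order all_algebra.
From mathcomp Require Import boolp classical_sets cardinality.

Local Open Scope classical_set_scope.
Local Open Scope ring_scope.

(** Finiteness is a Noetherian argument on the complements, which are closed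
    upwards in [N^n].

    For a set [G] of exponents, consider the max-compatible order ideals that
    avoid [G], and suppose that there are infinitely many of them. They all lie
    in [avoiding G], the largest order ideal that avoids [G]. If [avoiding G]
    were compatible, each of them would be equal to it, because a max-compatible
    set is maximal among compatible sets
    ([max_compatible_maximal]); so [avoiding G] contains two distinct equivalent
    exponents [a] and [b]. No compatible set contains both, hence infinitely
    many of the ideals avoid [a], or infinitely many avoid [b]. That exponent can
    be added to [G], and it lies above no element of [G]
    ([infinite_ideals_avoiding_extend]).

    Starting from the empty [G] and repeating, infinitely many max-compatible
    order ideals would produce an infinite sequence of exponents none of which
    lies above an earlier one, which Dickson's lemma ([dickson]) forbids. *)

(** Past any index the sequence attains its minimum over the remaining indices;
    jumping from one such minimum to the next gives the subsequence. *)
Lemma nondecreasing_subsequence (g : nat -> nat) :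
  exists h : nat -> nat,
    {homo h : i j / (i < j)%N} /\ {homo g \o h : i j / (i <= j)%N}.
Proof.
have tail_min m :
    exists k, (m <= k)%N /\ forall l, (k <= l)%N -> (g k <= g l)%N.
  pose P v := `[< exists2 k, (m <= k)%N & g k = v >].
  have exP : exists v, P v by exists (g m); apply/asboolP; exists m.
  case: (ex_minnP exP) => v /asboolP[k mk <-] kmin.
  exists k; split=> // l kl; apply: kmin; apply/asboolP.
  by exists l => //; exact: leq_trans kl.
have [K K_min] := choice tail_min.
pose h := fix h i := if i is i'.+1 then K (h i').+1 else K 0%N.
have h_lt i : (h i < h i.+1)%N by case: (K_min (h i).+1).
have h_min i l : (h i <= l)%N -> (g (h i) <= g l)%N.
  by case: i => [|i] /=; [case: (K_min 0%N)|case: (K_min (h i).+1)] => _; apply.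
exists h; split; first by apply: homo_ltn => //; exact: ltn_trans.
apply: homo_leq => [//|y x z xy yz|i]; first exact: leq_trans xy yz.
by apply: h_min; exact: ltnW.
Qed.

(** Thinning out the sequence once per coordinate makes all coordinates
    nondecreasing, since a subsequence of a nondecreasing sequence is
    nondecreasing. *)
Lemma dickson {n : nat} (f : nat -> 'rV[nat]_n) :
  exists i j, (i < j)%N /\ prec (f i) (f j).
Proof.
have thin k : exists h : nat -> nat, {homo h : i j / (i < j)%N} /\
    forall c : 'I_n, (c < k)%N ->
      {homo (fun i => f (h i) ord0 c) : i j / (i <= j)%N}.
  elim: k => [|k [h [h_lt h_le]]];
    first by exists id; split=> [i j|c]; rewrite ?ltn0.
  have [kn|nk] := ltnP k n; last first.
    by exists h; split=> // c _; apply: h_le; exact: leq_trans (ltn_ord c) nk.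
  have [h' [h'_lt h'_le]] :=
    nondecreasing_subsequence (fun i => f (h i) ord0 (Ordinal kn)).
  exists (h \o h'); split=> [i j ij|c]; first by apply: h_lt; exact: h'_lt.
  rewrite ltnS leq_eqVlt => /orP[/eqP ck|ck] i j ij /=.
    have -> : c = Ordinal kn by exact: val_inj.
    exact: h'_le.
  by apply: h_le => //; exact: (ltnW_homo h'_lt).
have [h [h_lt h_le]] := thin n.
exists (h 0%N), (h 1%N); split; first exact: h_lt.
by move=> c; exact: h_le.
Qed.

(** An element of [K] is equivalent to some element of [O]; both lie in [K], so
    they coincide. *)
Lemma max_compatible_maximal {n : nat} {M : set 'rV[int]_n}
    {O K : set 'rV[nat]_n} :
  max_compatible M O -> compatible M K -> O `<=` K -> O = K.
Proof.
move=> [_ O_full] K_compat OK; apply/seteqP; split=> // u Ku.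
have [b Ob ub] := O_full (to_int u).
by rewrite (K_compat u b Ku (OK b Ob) ub).
Qed.

Definition avoiding {n : nat} (G : set 'rV[nat]_n) : set 'rV[nat]_n :=
  [set u | forall g, G g -> ~ prec g u].

Definition ideals_avoiding {n : nat} (M : set 'rV[int]_n)
    (G : set 'rV[nat]_n) : set (set 'rV[nat]_n) :=
  [set O | [/\ order_ideal O, max_compatible M O & forall g, G g -> ~ O g]].

Lemma ideals_avoiding_sub {n : nat} {M : set 'rV[int]_n}
    {G O : set 'rV[nat]_n} :
  ideals_avoiding M G O -> O `<=` avoiding G.
Proof.
by move=> [O_ideal _ OG] u Ou g Gg gu; apply: (OG g Gg); exact: O_ideal Ou g gu.
Qed.

Lemma ideals_avoiding_setU1 {n : nat} {M : set 'rV[int]_n}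
    {G O : set 'rV[nat]_n} {a : 'rV[nat]_n} :
  ideals_avoiding M G O -> ~ O a -> ideals_avoiding M (a |` G) O.
Proof. by move=> [idO maxO OG] Oa; split=> // g [->|/OG]. Qed.

(** Two distinct equivalent elements of [avoiding G] exist, since otherwise
    [avoiding G] would be the only ideal counted. Each ideal misses at least one
    of the two, so the ideals are covered by two families, one of which is
    infinite. *)
Lemma infinite_ideals_avoiding_extend {n : nat} {M : set 'rV[int]_n}
    {G : set 'rV[nat]_n} :
  infinite_set (ideals_avoiding M G) ->
  exists2 a, avoiding G a & infinite_set (ideals_avoiding M (a |` G)).
Proof.
move=> infG.
have /existsNP[a /existsNP[b]] : ~ compatible M (avoiding G).
  move=> K_compat; apply: infG.
  apply: (@sub_finite_set _ _ [set avoiding G]) => // O OG.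
  have [_ maxO _] := OG.
  exact: max_compatible_maximal maxO K_compat (ideals_avoiding_sub OG).
move=> /not_implyP[Ka /not_implyP[Kb /not_implyP[ab neq_ab]]].
have [fin_a|inf_a] := pselect (finite_set (ideals_avoiding M (a |` G)));
  last by exists a.
exists b => // fin_b; apply: infG.
apply: (@sub_finite_set _ _
  (ideals_avoiding M (a |` G) `|` ideals_avoiding M (b |` G))).
  move=> O OG; have [Oa|nOa] := pselect (O a); last first.
    by left; exact: ideals_avoiding_setU1.
  right; apply: ideals_avoiding_setU1 => // Ob.
  by have [_ [O_compat _] _] := OG; exact: neq_ab (O_compat a b Oa Ob ab).
by rewrite finite_setU.
Qed.

Theorem proposition13 (n : nat) (hn : (1 <= n)%N) (M : set 'rV[int]_n)
    (hM : GRing.zmod_closed [in M]) :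
  finite_set [set O : set 'rV[nat]_n | order_ideal O /\ max_compatible M O].
Proof.
apply: contrapT => inf_ideals.
have /choice[next next_spec] (G : set 'rV[nat]_n) : exists a,
    infinite_set (ideals_avoiding M G) ->
    avoiding G a /\ infinite_set (ideals_avoiding M (a |` G)).
  have [/infinite_ideals_avoiding_extend[a Ka inf_a]|finG] :=
    pselect (infinite_set (ideals_avoiding M G)); first by exists a.
  by exists 0 => /finG.
pose G k := iter k (fun G => next G |` G) set0.
have inf_G k : infinite_set (ideals_avoiding M (G k)).
  elim: k => [|k /next_spec[]//]; apply: contra_not inf_ideals.
  by apply: sub_finite_set => O [idO maxO]; split.
have next_in_G i j : (i < j)%N -> G j (next (G i)).
  elim: j => // j IHj; rewrite ltnS leq_eqVlt => /orP[/eqP->|/IHj]; first by left.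
  by right.
have [i [j [ij]]] := dickson (next \o G).
by have [/(_ _ (next_in_G i j ij))] := next_spec _ (inf_G j).
Qed.
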